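(* For fixed sample $M$ of $m$ users, Dwork's Density Estimator provides an unbiased estimate $\tilde d$ of the density $d(\mathcal{S}_M)$ of $\mathcal{S}_M$ and has mean squared error $$\mathbb{E}\bigl[(\tilde d-d(\mathcal{S}_M))^2\bigr]\le\frac{2(2m+1)}{m^2\varepsilon^2}.$$
   Context: Streams: $\mathcal{U}$ is a finite universe of users; a data stream is a finite sequence $\mathcal{S}=(s_1,\dots,s_T)$ with $s_t\in\mathcal{U}$. For a set $M\subseteq\mathcal{U}$ of $m$ users, $\mathcal{S}_M$ is the subsequence of $\mathcal{S}$ consisting of the updates $s_t\in M$, and its density $d(\mathcal{S}_M)$ is the fraction of the $m$ users of $M$ that appear in it (at least once). Dwork's Density Estimator (privacy parameter $0<\varepsilon\le\frac12$, sample size $m$): sample a random subset $M\subseteq\mathcal{U}$ of $m$ users without replacement, ordered as $M[1],\dots,M[m]$; keep a bit array $\mathbf{b}=[b_1\ \dots\ b_m]$, with entries initialized independently as $b_i\sim\mathrm{Bernoulli}(\frac12)$. For $t=1,\dots,T$: if $s_t=M[i]$ for some $i$, re-sample $b_i\sim\mathrm{Bernoulli}(\frac12+\frac\varepsilon4)$ (with fresh randomness). At the end output $$\tilde d=\frac4\varepsilon\Bigl(\frac1m\sum_{i=1}^m b_i-\frac12\Bigr)+\mathrm{Laplace}\bigl(0,\tfrac1{\varepsilon m}\bigr),$$ where $\mathrm{Laplace}(0,s)$ denotes an independent random variable with density $\frac1{2s}e^{-|x|/s}$. The expectation is over the bits and the Laplace noise, with $\mathcal{S}$ and $M$ fixed.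 *)

(* Defs.v *)
From HB Require Import structures.
From mathcomp Require Import all_boot all_order all_algebra.
From mathcomp Require Import all_classical all_reals all_analysis.

Set Implicit Arguments.
Unset Strict Implicit.
Unset Printing Implicit Defensive.

Import Order.TTheory GRing.Theory Num.Theory.
Import numFieldNormedType.Exports.

Local Open Scope ring_scope.

Section Streams.
Context {U : finType}.

Definition substream (M : {set U}) (S : seq U) : seq U :=
  [seq u <- S | u \in M].

Definition density {R : realType} (M : {set U}) (S : seq U) : R :=
  #|[set u in M | u \in substream M S]|%:R / #|M|%:R.

End Streams.

Section Estimator.
Context {R : realType} {U : finType} {m : nat}.
Implicit Types (M : m.-tuple U) (b : {ffun 'I_m -> bool}).

(* One step on the stream element [sr.1], with [sr.2] the value drawn at that
   step; the draw is ignored when [sr.1] is not in the sample. *)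
Definition dde_step M b (sr : U * bool) : {ffun 'I_m -> bool} :=
  [ffun i => if tnth M i == sr.1 then sr.2 else b i].

Definition dde_bits M (S : seq U) b (r : seq bool) : {ffun 'I_m -> bool} :=
  foldl (dde_step M) b (zip S r).

Definition dde_output (eps : R) M (S : seq U) b (r : seq bool) (z : R) : R :=
  4 / eps * ((\sum_(i < m) (dde_bits M S b r i)%:R) / m%:R - 1 / 2) + z.

End Estimator.

Section Laplace.
Context {R : realType}.

Definition laplace_pdf (s x : R) : R := (2 * s)^-1 * expR (- `|x| / s).

(* centred at 0, with scale [s]; meaningful for [0 < s] *)
Definition laplace_prob (s : R) (A : set R) : \bar R :=
  (\int[lebesgue_measure]_(x in A) (laplace_pdf s x)%:E)%E.

End Laplace.

Section Randomness.
Context {d : measure_display} {Omega : measurableType d} {R : realType}.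
Context (P : probability Omega R).

(* The [G i] are families of events, so that random variables with values in
   different spaces can be declared jointly independent. *)
Definition mutual_independence (I : finType) (G : I -> set (set Omega)) :=
  forall (J : {set I}) (A : I -> set Omega),
    (forall i, i \in J -> G i (A i)) ->
    P (\bigcap_(i in [set` J]) A i)%classic = (\prod_(i in J) P (A i))%E.

Context {m T : nat}.
Context (init : 'I_m -> {RV P >-> bool}) (fresh : 'I_T -> {RV P >-> bool}).
Context (noise : {RV P >-> R}).

Definition dde_draws (k : 'I_m + 'I_T + unit) : set (set Omega) :=
  match k with
  | inl (inl i) => g_sigma_algebra_preimage (init i)
  | inl (inr t) => g_sigma_algebra_preimage (fresh t)
  | inr tt => g_sigma_algebra_preimage noise
  end.

Definition dde_estimate {U : finType} (eps : R) (M : m.-tuple U)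
    (S : T.-tuple U) (w : Omega) : R :=
  dde_output eps M S [ffun i => init i w] [tuple fresh t w | t < T] (noise w).

End Randomness.

(* Main.v *)
Require Import Defs.
From mathcomp Require Import all_boot all_order all_algebra.
From mathcomp Require Import all_classical all_reals all_analysis.
From mathcomp Require Import measurable_realfun ring lra.

Import Order.TTheory GRing.Theory Num.Theory.
Import numFieldNormedType.Exports.

Local Open Scope classical_set_scope.
Local Open Scope ring_scope.

(** The final bit of a sampled user is a single draw: the fresh bit of the last
    step at which the user appears, or the initial bit if there is no such step.
    Distinct users read distinct draws, so the final bits are independent, with
    mean 1/2 + eps/4 or 1/2 according to whether the user appears. The mean of
    the estimate follows; its variance splits into (4 / (eps m))^2 times at most
    m / 4 for the bits, plus 2 / (eps m)^2 for the Laplace noise. *)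

(** * Integration against a measure given by a density *)

Section density.
Import HBNNSimple.

(** By monotone convergence along simple functions increasing to [f], it suffices to treat a simple
    function; that one splits over its finite range, and the hypothesis on [nu] settles each level
    set. *)
Lemma ge0_integral_density d (T : measurableType d) (R : realType)
    (nu mu : {measure set T -> \bar R}) (g : T -> R) (f : T -> \bar R) :
  (forall x, 0 <= g x) -> measurable_fun [set: T] g ->
  (forall A, measurable A -> nu A = (\int[mu]_(x in A) (g x)%:E)%E) ->
  (forall x, (0 <= f x)%E) -> measurable_fun setT f ->
  (\int[nu]_x f x = \int[mu]_x (f x * (g x)%:E))%E.
Proof.
move=> g0 mg nuE f0 mf; pose h := nnsfun_approx measurableT mf.
have mge : measurable_fun [set: T] (EFin \o g) by exact/measurable_EFinP.
have hf x : (h n x)%:E @[n --> \oo] --> f x.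
  by apply: cvg_nnsfun_approx => // y _; exact: f0.
have nd x : {homo (fun n => h n x) : m n / (m <= n)%N >-> m <= n}.
  by move=> m n mn; exact/lefP/nd_nnsfun_approx.
have -> : (\int[nu]_x f x = limn (fun n => \int[nu]_x (h n x)%:E))%E.
  rewrite -monotone_convergence//.
  - by apply: eq_integral => x _; exact/esym/cvg_lim.
  - by move=> n; exact/measurable_EFinP.
  - by move=> n x _; rewrite lee_fin.
  - by move=> x _ m n mn; rewrite lee_fin; exact: nd.
have -> : (\int[mu]_x (f x * (g x)%:E) =
    limn (fun n => \int[mu]_x ((h n x)%:E * (g x)%:E)))%E.
  rewrite -monotone_convergence//.
  - by apply: eq_integral => x _; apply/esym/cvg_lim => //; exact: cvgeZr.
  - by move=> n; apply: emeasurable_funM => //; exact/measurable_EFinP.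
  - by move=> n x _; rewrite mule_ge0 ?lee_fin.
  - by move=> x _ m n mn; rewrite lee_wpmul2r ?lee_fin//; exact: nd.
apply: congr_lim; apply/funext => n.
have hE x : ((h n x)%:E * (g x)%:E = \sum_(y \in range (h n))
    y%:E * ((\1_(h n @^-1` [set y]) x)%:E * (g x)%:E))%E.
  rewrite {1}fimfunE -fsumEFin// ge0_mule_fsuml; last first.
    by move=> r; rewrite EFinM nnfun_muleindic_ge0.
  by apply: eq_fsbigr => y _; rewrite EFinM muleA.
rewrite integralT_nnsfun sintegralE.
under [RHS]eq_integral do rewrite hE.
have mig y : measurable_fun [set: T]
    (fun x => ((\1_(h n @^-1` [set y]) x)%:E * (g x)%:E)%E).
  by apply: emeasurable_funM => //; exact/measurable_EFinP.
rewrite ge0_integral_fsum//; last 2 first.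
- by move=> y; apply: measurable_funeM.
- move=> y x _; rewrite muleA mule_ge0 ?lee_fin//.
  exact: nnfun_muleindic_ge0.
apply: eq_fsbigr => y /[!inE] -[x _ <-].
rewrite ge0_integralZl//; last 2 first.
- by move=> z _; rewrite mule_ge0 ?lee_fin.
- by rewrite lee_fin.
rewrite nuE// integral_mkcond; congr (_ * _)%E; apply: eq_integral => z _.
by rewrite epatch_indic muleC.
Qed.

End density.

(* By independence, the image under Z of P restricted to B has density
   P B * g. *)
Lemma ge0_integral_indep_density d (T : measurableType d) (R : realType)
    (P : probability T R) (B : set T) (Z : {RV P >-> R}) (g : R -> R)
    (f : R -> \bar R) :
  measurable B -> (forall x, 0 <= g x) -> measurable_fun [set: R] g ->
  (forall A : set R, measurable A ->
    distribution P Z A = (\int[lebesgue_measure]_(x in A) (g x)%:E)%E) ->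
  (forall A : set R, measurable A ->
    P (B `&` Z @^-1` A) = (P B * P (Z @^-1` A))%E) ->
  (forall x, (0 <= f x)%E) -> measurable_fun [set: R] f ->
  (\int[P]_(w in B) f (Z w) =
   P B * \int[lebesgue_measure]_x (f x * (g x)%:E))%E.
Proof.
move=> mB g0 mg ZE BZ f0 mf.
have PBE : P B = (fine (P B))%:E by rewrite fineK// fin_num_measure.
have mfZ : measurable_fun [set: T] (f \o Z) by exact: measurableT_comp.
(* [mrestr P mB] has density [\1_B] with respect to [P], so the density lemma serves twice: here,
   and for the image measure below. *)
have -> : (\int[P]_(w in B) f (Z w) = \int[mrestr P mB]_w f (Z w))%E.
  rewrite (@ge0_integral_density _ _ _ (mrestr P mB) P \1_B)//.
    rewrite [LHS]integral_mkcond; apply: eq_integral => w _.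
    by rewrite epatch_indic.
  by move=> A mA; rewrite integral_indic// /mrestr setIC.
(* [lebesgue_measure] lives on [measurableTypeR R], whose display differs from
   that of [R] although the measurable sets are convertible. *)
have mZ : measurable_fun [set: T] (Z : T -> measurableTypeR R).
  exact: (@measurable_funPT _ _ _ _ Z).
transitivity (\int[pushforward (mrestr P mB) (Z : T -> measurableTypeR R)]_x
    f x)%E.
  by rewrite ge0_integral_pushforward.
rewrite [LHS](@ge0_integral_density _ (measurableTypeR R) _ _ lebesgue_measure
  (fun x => fine (P B) * g x))//.
- rewrite PBE -ge0_integralZl//; last 3 first.
  + by apply: emeasurable_funM; [exact: mf|exact/measurable_EFinP].
  + by move=> x _; rewrite mule_ge0// lee_fin.
  + by rewrite lee_fin fine_ge0.
  by apply: eq_integral => x _; rewrite EFinM muleCA.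
- by move=> x; rewrite mulr_ge0// fine_ge0.
- exact: measurable_funM.
- move=> A mA; transitivity (P B * distribution P Z A)%E.
    by rewrite -BZ// setIC.
  rewrite ZE// PBE -ge0_integralZl//.
  + by apply/measurable_EFinP; exact: measurable_funTS.
  + by move=> x _; rewrite lee_fin.
  + by rewrite lee_fin fine_ge0.
Qed.

(** * The Laplace density and its second moment *)

Section laplace_moments.
Context {R : realType} {s : R}.
Hypothesis s_gt0 : 0 < s.

Lemma laplace_pdf_ge0 x : 0 <= laplace_pdf s x.
Proof. by rewrite mulr_ge0 ?expR_ge0// invr_ge0 mulr_ge0// ltW. Qed.

Lemma continuous_laplace_pdf : continuous (laplace_pdf s).
Proof.
move=> x; rewrite /laplace_pdf; apply: cvgM; first exact: cvg_cst.
apply: (@continuous_comp _ _ _ (fun y : R => - `|y| / s)).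
  apply: cvgM; last exact: cvg_cst.
  by apply: cvgN; exact: norm_continuous.
exact: continuous_expR.
Qed.

Lemma measurable_laplace_pdf : measurable_fun [set: R] (laplace_pdf s).
Proof. exact: continuous_measurable_fun continuous_laplace_pdf. Qed.

(** On the half-line the absolute value disappears from the density. The reduction serves both the
    second moment and the first absolute moment. *)
Lemma ge0_integral_laplace_even (f : R -> R) :
  (forall x, 0 <= f x) -> continuous f -> f =1 f \o -%R ->
  (\int[lebesgue_measure]_x ((f x)%:E * (laplace_pdf s x)%:E) =
   2%:E * \int[lebesgue_measure]_(x in `[0%R, +oo[)
            (f x * laplace_pdf s x)%:E)%E.
Proof.
move=> f0 cf fN.
rewrite (@ge0_symfun_integralT _ (fun x => f x * laplace_pdf s x))//.
- by rewrite set_itvcy.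
- by move=> x; rewrite mulr_ge0// laplace_pdf_ge0.
- by move=> x; apply: cvgM; [exact: cf|exact: continuous_laplace_pdf].
- by move=> x /=; rewrite -[f x]/(f x) fN /laplace_pdf normrN.
Qed.

(** Boundary term at infinity of the antiderivative used for the second moment. *)
Lemma cvg_sqr_expRN :
  (fun y : R => (y ^+ 2 + 2 * y + 2) * expR (- y)) y @[y --> +oo] --> (0 : R).
Proof.
apply/cvgrPdist_le => e e0; near=> y.
have y1 : 1 <= y by near: y; apply: nbhs_pinfty_ge; exact: num_real.
(* 30 = 5 * 6: for y >= 1 the polynomial is at most 5 y^2, and
   e^y >= y^3 / 6. *)
have y30 : 30 / e <= y by near: y; apply: nbhs_pinfty_ge; exact: num_real.
have y0 : 0 < y by lra.
rewrite sub0r normrN ger0_norm; last by rewrite mulr_ge0 ?expR_ge0//; nra.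
rewrite expRN ler_pdivrMr ?expR_gt0//.
have := @expR_ge1Dxn R y 2 (ltW y0); rewrite (_ : 3`!%:R = 6)//.
move=> h; apply: (@le_trans _ _ (e * (y ^+ 3 / 6))); last first.
  by rewrite ler_pM2l//; lra.
have : 30 <= e * y by rewrite mulrC -ler_pdivrMr.
move=> ey.
have : 30 * y ^+ 2 <= e * y ^+ 3.
  rewrite (_ : e * y ^+ 3 = e * y * y ^+ 2); last by ring.
  by rewrite ler_wpM2r ?sqr_ge0.
nra.
Unshelve. all: by end_near. Qed.

(** Fundamental theorem of calculus for the antiderivative [F], which tends to 0 at infinity and
    equals [- s ^+ 2] at 0. *)
Lemma integral_sqr_laplace_half :
  (\int[lebesgue_measure]_(x in `[0%R, +oo[) (x ^+ 2 * laplace_pdf s x)%:E =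
   (s ^+ 2)%:E)%E.
Proof.
pose E (x : R) : R := expR (- (x / s)).
(* With u = x / s, integrating u^2 e^(-u) by parts twice gives -(u^2 + 2u + 2) e^(-u); the factor
   s^2 / 2 comes from the substitution and the normalization 1 / (2s). *)
pose F (x : R) : R := - (s ^+ 2 / 2) * (((x / s) ^+ 2 + 2 * (x / s) + 2) * E x).
pose f (x : R) : R := x ^+ 2 * ((2 * s)^-1 * E x).
have dE (x : R) : is_derive x 1 E (- s^-1 * E x).
  rewrite /E -[fun _ => _]/(expR \o (fun x => - (x / s))).
  apply: is_derive_eq.
  by rewrite /GRing.scale/= /E; field; rewrite gt_eqF.
have dF (x : R) : is_derive x 1 F (f x).
  rewrite /F; apply: is_derive_eq.
  by rewrite /f /GRing.scale/=; field; rewrite gt_eqF.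
have cE : continuous E.
  move=> x; apply: differentiable_continuous; apply/derivable1_diffP.
  exact: ex_derive.
have cf : continuous f.
  move=> x; apply: cvgM; first exact: exprn_continuous.
  by apply: cvgM; [exact: cvg_cst|exact: cE].
transitivity (\int[lebesgue_measure]_(x in `[0%R, +oo[) (f x)%:E)%E.
  apply: eq_integral => x; rewrite inE/= in_itv/= andbT => x0.
  by rewrite /laplace_pdf ger0_norm// mulNr.
rewrite (@ge0_continuous_FTC2y _ f F 0 0).
- by rewrite /F /E mul0r oppr0 expR0 sub0e -EFinN; congr EFin; field.
- move=> x _; rewrite mulr_ge0 ?sqr_ge0// mulr_ge0 ?expR_ge0// invr_ge0.
  by rewrite mulr_ge0// ltW.
- exact: continuous_subspaceT.
- rewrite -[X in _ --> X](mulr0 (- (s ^+ 2 / 2))).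
  apply: cvgM; first exact: cvg_cst.
  apply: (@cvg_comp _ _ _ (fun x => x / s) _ _ (pinfty_nbhs R) _ _
    cvg_sqr_expRN).
  by apply: gt0_cvgMly => //; rewrite invr_gt0.
- by move=> x _; exact: ex_derive.
- apply/cvg_at_right_filter; apply: differentiable_continuous.
  apply/derivable1_diffP.
  exact: ex_derive.
- by move=> x _; rewrite derive1E; exact: derive_val.
Qed.

End laplace_moments.

(** Turns a finite second moment into the L2 membership that the variance and covariance lemmas ask
    for. *)
Lemma sqr_integral_lty_Lfun2 d (T : measurableType d) (R : realType)
    (mu : {measure set T -> \bar R}) (X : T -> R) :
  measurable_fun [set: T] X -> (\int[mu]_w (X w ^+ 2)%:E < +oo)%E ->
  X \in Lfun mu 2%:E.
Proof.
move=> mX X2; rewrite inE; apply/andP; split; rewrite inE//=.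
rewrite /finite_norm unlock poweR_lty//.
by under eq_integral do rewrite /= powR_mulrn// real_normK ?num_real//.
Qed.

(** * Moments of the Laplace noise, also over independent events *)

Section laplace_noise.
Context {d : measure_display} {T : measurableType d} {R : realType}.
Context {P : probability T R} {Z : {RV P >-> R}} {s : R}.
Hypothesis s_gt0 : 0 < s.
Hypothesis ZE : forall A : set R, measurable A ->
  distribution P Z A = laplace_prob s A.

(** [B] is general for two uses: the whole space gives the moments of the noise, and the event that
    a bit is 1 gives its covariance with that bit. *)
Lemma ge0_integral_indep_laplace (B : set T) (f : R -> \bar R) :
  measurable B ->
  (forall A : set R, measurable A ->
    P (B `&` Z @^-1` A) = (P B * P (Z @^-1` A))%E) ->
  (forall x, (0 <= f x)%E) -> measurable_fun [set: R] f ->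
  (\int[P]_(w in B) f (Z w) =
   P B * \int[lebesgue_measure]_x (f x * (laplace_pdf s x)%:E))%E.
Proof.
move=> mB BZ f0 mf; apply: ge0_integral_indep_density => //.
- exact: laplace_pdf_ge0.
- exact: measurable_laplace_pdf.
Qed.

Lemma ge0_expectation_laplace (f : R -> \bar R) :
  (forall x, (0 <= f x)%E) -> measurable_fun [set: R] f ->
  (\int[P]_w f (Z w) =
   \int[lebesgue_measure]_x (f x * (laplace_pdf s x)%:E))%E.
Proof.
move=> f0 mf; rewrite ge0_integral_indep_laplace ?probability_setT ?mul1e//.
by move=> A mA; rewrite setTI mul1e.
Qed.

Lemma expectation_sqr_laplace :
  (\int[P]_w (Z w ^+ 2)%:E = (2 * s ^+ 2)%:E)%E.
Proof.
rewrite (ge0_expectation_laplace (fun x => (x ^+ 2)%:E)).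
- rewrite (ge0_integral_laplace_even s_gt0 (fun x => x ^+ 2))//.
  + by rewrite integral_sqr_laplace_half.
  + by move=> x; exact: sqr_ge0.
  + exact: exprn_continuous.
  + by move=> x /=; rewrite sqrrN.
- by move=> x; rewrite lee_fin sqr_ge0.
- by apply/measurable_EFinP; exact: measurable_funX.
Qed.

Lemma Lfun2_laplace : (Z : T -> R) \in Lfun P 2%:E.
Proof.
apply: sqr_integral_lty_Lfun2; first exact: measurable_funPT.
by rewrite expectation_sqr_laplace ltry.
Qed.

Lemma integrable_laplace : P.-integrable [set: T] (EFin \o Z).
Proof.
apply/Lfun1_integrable; apply: Lfun_subset12 Lfun2_laplace.
exact: fin_num_measure.
Qed.

Lemma integral_laplace_funepos_funeneg :
  (\int[lebesgue_measure]_x ((@EFin R)^\+ x * (laplace_pdf s x)%:E) =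
   \int[lebesgue_measure]_x ((@EFin R)^\- x * (laplace_pdf s x)%:E))%E.
Proof.
set K := (X in X = _); set K' := (X in _ = X).
have mEFin : measurable_fun [set: R] (@EFin R) by exact/measurable_EFinP.
have mpdf : measurable_fun [set: measurableTypeR R]
    (fun x => (laplace_pdf s x)%:E).
  by apply/measurable_EFinP; exact: measurable_laplace_pdf.
(* [K] is the integral under [P] of the positive part of [Z], finite because [Z] is integrable. *)
have Kfin : K \is a fin_num.
  rewrite /K -ge0_expectation_laplace//; last exact: measurable_funepos.
  apply: integrable_fin_num => //.
  have := integrable_funepos measurableT integrable_laplace.
  by rewrite funepos_comp.
(* K + K' is the first absolute moment, which is 2 K because the density is
   even; as K is finite, K' = K. *)
have KD : (K + K' = K + K)%E.
  rewrite -ge0_integralD//; last 4 first.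
  - by move=> x _; rewrite mule_ge0// lee_fin laplace_pdf_ge0.
  - by apply: emeasurable_funM mpdf; exact: measurable_funepos.
  - by move=> x _; rewrite mule_ge0// lee_fin laplace_pdf_ge0.
  - by apply: emeasurable_funM mpdf; exact: measurable_funeneg.
  transitivity (\int[lebesgue_measure]_x (`|x|%:E * (laplace_pdf s x)%:E))%E.
    apply: eq_integral => x _; rewrite -ge0_muleDl//; congr (_ * _)%E.
    rewrite funeposE funenegE -EFinN; have [x0|x0] := leP 0 (x : R).
      by rewrite max_l ?lee_fin// max_r ?lee_fin ?oppr_le0// adde0 ger0_norm.
    rewrite max_r ?lee_fin ?(ltW x0)// max_l ?lee_fin ?oppr_ge0 ?(ltW x0)//.
    by rewrite add0e ltr0_norm.
  rewrite (ge0_integral_laplace_even s_gt0 (fun x => `|x|))//; last 2 first.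
    exact: norm_continuous.
    by move=> x /=; rewrite normrN.
  rewrite mule_natl mule2n.
  (* The positive part of x vanishes for x < 0, so [K] is already a half-line integral. *)
  suff -> : K = (\int[lebesgue_measure]_(x in `[0%R, +oo[)
      (`|x| * laplace_pdf s x)%:E)%E by [].
  rewrite integral_mkcond; apply: eq_integral => x _; rewrite patchE.
  case: ifPn => [|/negP]; rewrite inE/= in_itv/= andbT => x0.
    by rewrite funeposE max_l ?lee_fin// ger0_norm.
  by rewrite funeposE max_r ?mul0e// lee_fin ltW// ltNge; exact/negP.
by rewrite -[K'](addeK _ Kfin) [(K' + K)%E]addeC KD addeK.
Qed.

(** Independence factors [P B] out of the integrals of both parts of [Z]. Symmetry of the density
    makes these equal and integrability makes them finite, so their difference in the extended reals
    is 0. *)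
Lemma integral_indep_laplace (B : set T) :
  measurable B ->
  (forall A : set R, measurable A ->
    P (B `&` Z @^-1` A) = (P B * P (Z @^-1` A))%E) ->
  (\int[P]_(w in B) (Z w)%:E = 0)%E.
Proof.
move=> mB BZ; rewrite integralE.
have mEFin : measurable_fun [set: R] (@EFin R) by exact/measurable_EFinP.
have pos : (\int[P]_(w in B) ((EFin \o Z)^\+ w) = P B *
    \int[lebesgue_measure]_x ((@EFin R)^\+ x * (laplace_pdf s x)%:E))%E.
  rewrite -ge0_integral_indep_laplace//; first by rewrite funepos_comp.
  exact: measurable_funepos.
have neg : (\int[P]_(w in B) ((EFin \o Z)^\- w) = P B *
    \int[lebesgue_measure]_x ((@EFin R)^\- x * (laplace_pdf s x)%:E))%E.
  rewrite -ge0_integral_indep_laplace//; first by rewrite funeneg_comp.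
  exact: measurable_funeneg.
rewrite neg -integral_laplace_funepos_funeneg -pos subee//.
apply: integrable_fin_num => //; apply: integrable_funepos => //.
exact: integrableS integrable_laplace.
Qed.
End laplace_noise.

(** * Indicators and sums of uncorrelated variables *)

Section uncorrelated.
Context {d : measure_display} {T : measurableType d} {R : realType}.
Context (P : probability T R).
Local Open Scope ereal_scope.

Lemma Lfun2_indic (A : set T) : measurable A -> (\1_A : T -> R) \in Lfun P 2%:E.
Proof.
move=> mA; apply: sqr_integral_lty_Lfun2 => //.
rewrite (eq_integral (fun w => (\1_A w)%:E)).
  by rewrite integral_indic// setIT ltey_eq fin_num_measure.
by move=> w _; rewrite indicE; case: (_ \in _); rewrite ?expr1n ?expr0n.
Qed.

Lemma Lfun2_Lfun1 (X : T -> R) : X \in Lfun P 2%:E -> X \in Lfun P 1.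
Proof. by apply: Lfun_subset12; exact: fin_num_measure. Qed.

Lemma covariance_indic_indep (A B : set T) :
  measurable A -> measurable B -> P (A `&` B) = P A * P B ->
  covariance P \1_A \1_B = 0.
Proof.
move=> mA mB AB; have [A2 B2] := (Lfun2_indic _ mA, Lfun2_indic _ mB).
rewrite covarianceE ?(Lfun2_mul_Lfun1 A2 B2)//; try exact: Lfun2_Lfun1.
rewrite -[(\1_A * \1_B)%R]/(\1_A \* \1_B)%R -indicI.
rewrite !expectation_indic//; last exact: measurableI.
by rewrite AB subee// fin_numM// fin_num_measure.
Qed.

(** With p = P A the variance is p - p^2, and (p - 1/2)^2 is nonnegative. *)
Lemma variance_indic_le (A : set T) : measurable A ->
  'V_P[\1_A] <= (1 / 4)%:E.
Proof.
move=> mA; rewrite varianceE ?Lfun2_indic//.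
have -> : (\1_A ^+ 2 = \1_A :> (T -> R))%R.
  apply/funext => w; rewrite -[LHS]/(\1_A w ^+ 2)%R indicE.
  by case: (_ \in _); rewrite ?expr1n ?expr0n.
rewrite expectation_indic// -(fineK (fin_num_measure P A mA)).
rewrite -EFin_expe -EFinB lee_fin; set p := fine _.
by have := sqr_ge0 (p - 1 / 2); nra.
Qed.

Lemma Lfun2_sum (I : Type) (r : seq I) (X : I -> T -> R) :
  (forall i, X i \in Lfun P 2%:E) -> (\sum_(i <- r) X i)%R \in Lfun P 2%:E.
Proof.
move=> X2; elim: r => [|i r IH]; first by rewrite big_nil Lfun_cst.
by rewrite big_cons rpredD ?lee1n.
Qed.

Lemma covariance_suml_eq0 (I : eqType) (r : seq I) (X : I -> T -> R)
    (Y : T -> R) :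
  (forall i, X i \in Lfun P 2%:E) -> Y \in Lfun P 2%:E ->
  (forall i, i \in r -> covariance P (X i) Y = 0) ->
  covariance P (\sum_(i <- r) X i)%R Y = 0.
Proof.
move=> X2 Y2; elim: r => [_|i r IH XY].
  by rewrite big_nil covariance_cst_l.
rewrite big_cons covarianceDl ?Lfun2_sum// XY ?mem_head// add0e IH// => j jr.
by rewrite XY// inE jr orbT.
Qed.

(** Induction on [r]: by uniqueness the head differs from every later index, so its covariance with
    the sum of the tail vanishes. *)
Lemma variance_sum_uncorrelated (I : eqType) (r : seq I) (X : I -> T -> R) :
  uniq r -> (forall i, X i \in Lfun P 2%:E) ->
  (forall i j, i != j -> covariance P (X i) (X j) = 0) ->
  'V_P[(\sum_(i <- r) X i)%R] = \sum_(i <- r) 'V_P[X i].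
Proof.
move=> ur X2 XX; elim: r ur => [_|i r IH /= /andP[ir ur]].
  by rewrite !big_nil variance_cst.
rewrite !big_cons varianceD ?Lfun2_sum// IH// covarianceC.
rewrite covariance_suml_eq0 ?mule0 ?adde0// => j jr.
by apply: XX; apply: contraNneq ir => <-.
Qed.

End uncorrelated.

(** Take the index set {k, l} and the family of events equal to [A] at [k] and to [B] elsewhere. *)
Lemma mutual_independence2 {d : measure_display} {Omega : measurableType d}
    {R : realType} {P : probability Omega R} {I : finType}
    {G : I -> set (set Omega)} (k l : I) (A B : set Omega) :
  mutual_independence P G -> k != l -> G k A -> G l B ->
  P (A `&` B) = (P A * P B)%E.
Proof.
move=> /(_ [set k; l]%SET (fun i => if i == k then A else B)) indep kl GA GB.
have := indep _; rewrite big_setU1 ?inE//= big_set1 eqxx eq_sym (negbTE kl).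
move=> <-.
  congr (P _); apply/seteqP; split => [w [Aw Bw] i|w h] /=.
    by move=> _; case: ifP.
  split; first by have /= := h k; rewrite !inE !eqxx => /(_ isT).
  by have /= := h l; rewrite !inE eq_sym (negbTE kl) eqxx => /(_ isT).
move=> i; rewrite !inE => /orP[]/eqP ->; first by rewrite eqxx.
by rewrite eq_sym (negbTE kl).
Qed.

(** * The draw behind each final bit, and the density as an average over indices *)

Section bits.
Context {U : finType} {m : nat} (M : m.-tuple U).

(** The position [t] is chosen before [b] and [r], so it depends on the stream and the sample only,
    not on the random values. The induction needs [b] general, since the first step alters the array
    passed to the rest. *)
Lemma dde_bits_seq_source (S : seq U) (i : 'I_m) :
  if tnth M i \in S then
    exists t, [/\ (t < size S)%N, nth (tnth M i) S t = tnth M i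
      & forall b r, size r = size S -> dde_bits M S b r i = nth false r t]
  else forall b r, dde_bits M S b r i = b i.
Proof.
elim: S => [|x S IH]; first by move=> b [].
(* If the user occurs in the tail, a later draw overrides the first one and the position shifts by
   one. Otherwise the first element decides between position 0 and the initial bit. *)
rewrite inE; case: (boolP (tnth M i \in S)) IH => [_ [t [tS St bt]]|_ IH].
  rewrite orbT; exists t.+1; split => // b [|y r]//= [] rS.
  by rewrite /dde_bits/= -/(dde_bits M S _ r) bt.
rewrite orbF; case: eqP => [Mx|Mx].
  exists 0%N; split => // b [|y r]//= rS.
  by rewrite /dde_bits/= -/(dde_bits M S _ r) IH ffunE Mx eqxx.
move=> b [|y r]; first by rewrite /dde_bits.
rewrite /dde_bits/= -/(dde_bits M S _ r) IH ffunE.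
by case: eqP.
Qed.

(** The source is an index of [dde_draws] other than the noise. Membership in [S] is kept for the
    means, and the link from source to user for injectivity. *)
Lemma dde_bits_source (T : nat) (S : T.-tuple U) (i : 'I_m) :
  exists k : 'I_m + 'I_T,
    match k with
    | inl j => [/\ j = i, tnth M i \notin S
        & forall b (r : T.-tuple bool), dde_bits M S b r i = b j]
    | inr t => [/\ tnth S t = tnth M i, tnth M i \in S
        & forall b (r : T.-tuple bool), dde_bits M S b r i = tnth r t]
    end.
Proof.
have := dde_bits_seq_source S i; case: ifPn => [MS [t [tS St bt]]|MS bS].
  have tT : (t < T)%N by rewrite size_tuple in tS.
  exists (inr (Ordinal tT)); split => //.
    by rewrite (tnth_nth (tnth M i)).
  by move=> b r; rewrite bt ?size_tuple// (tnth_nth false).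
by exists (inl i); split.
Qed.

(** As [M] has no repetition, [tnth M] is injective and users can be counted by their indices. *)
Lemma density_tuple (R : realType) (S : seq U) : uniq M ->
  density [set u in M]%SET S = (\sum_(i < m) (tnth M i \in S)%:R) / m%:R :> R.
Proof.
move=> uM; rewrite /density [X in _ / X%:R]cardsE (card_uniqP uM) size_tuple.
congr (_ / _); rewrite -natr_sum; congr (_%:R).
have -> : [set u in [set u in M]%SET | u \in substream [set u in M]%SET S]%SET =
    [set tnth M i | i in [set i | tnth M i \in S]%SET]%SET.
  apply/setP => u; rewrite !inE mem_filter !inE; apply/idP/imsetP.
    by case/and3P => /tnthP[i ->] _ iS; exists i; rewrite ?inE.
  by case=> i; rewrite inE => iS ->; rewrite mem_tnth.
rewrite card_imset; last exact/tuple_uniqP.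
rewrite cardsE -sum1_card big_mkcond/=; apply: eq_bigr => i _.
by rewrite -[i \in _]/(tnth M i \in S); case: (_ \in S).
Qed.

End bits.

(** * Pairwise independence of the draws and the noise *)

Section draws.
Context {d : measure_display} {Omega : measurableType d} {R : realType}.
Context {P : probability Omega R} {m T : nat}.
Context (init : 'I_m -> {RV P >-> bool}) (fresh : 'I_T -> {RV P >-> bool}).
Context (noise : {RV P >-> R}).
Hypothesis indep : mutual_independence P (dde_draws init fresh noise).

Definition dde_draw (k : 'I_m + 'I_T) : {RV P >-> bool} :=
  match k with inl i => init i | inr t => fresh t end.

Definition dde_heads (k : 'I_m + 'I_T) : set Omega :=
  dde_draw k @^-1` [set true].

Lemma measurable_dde_heads k : measurable (dde_heads k).
Proof. exact: measurable_funPTI. Qed.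

Lemma dde_draws_heads k : dde_draws init fresh noise (inl k) (dde_heads k).
Proof. by case: k => k; exists [set true]; rewrite // setTI. Qed.

Lemma dde_heads_indep k l : k != l ->
  P (dde_heads k `&` dde_heads l) = (P (dde_heads k) * P (dde_heads l))%E.
Proof.
move=> kl; apply: (mutual_independence2 (inl k) (inl l) _ _ indep).
- by apply: contra kl => /eqP[->].
- exact: dde_draws_heads.
- exact: dde_draws_heads.
Qed.

Lemma dde_heads_noise_indep k (A : set R) : measurable A ->
  P (dde_heads k `&` noise @^-1` A) =
  (P (dde_heads k) * P (noise @^-1` A))%E.
Proof.
move=> mA; apply: (mutual_independence2 (inl k) (inr tt) _ _ indep).
- by [].
- exact: dde_draws_heads.
- by exists A; rewrite // setTI.
Qed.

End draws.

(** * Mean and mean squared error of the estimate *)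

Theorem theorem4p2 (R : realType) (U : finType) (T m : nat) (eps : R)
    (S : T.-tuple U) (M : m.-tuple U)
    (d : measure_display) (Omega : measurableType d) (P : probability Omega R)
    (init : 'I_m -> {RV P >-> bool}) (fresh : 'I_T -> {RV P >-> bool})
    (noise : {RV P >-> R}) :
  0 < eps <= 1 / 2 ->
  (0 < m)%N ->
  uniq M ->
  (forall (i : 'I_m) (A : set bool),
     distribution P (init i) A = bernoulli_prob (1 / 2) A) ->
  (forall (t : 'I_T) (A : set bool),
     distribution P (fresh t) A = bernoulli_prob (1 / 2 + eps / 4) A) ->
  (forall A : set R, measurable A ->
     distribution P noise A = laplace_prob (1 / (eps * m%:R)) A) ->
  mutual_independence P (dde_draws init fresh noise) ->
  let dtilde := dde_estimate init fresh noise eps M S in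
  let dens : R := density [set u in M]%SET S in
  'E_P[dtilde]%E = dens%:E /\
  ('E_P[fun w => ((dtilde w - dens) ^+ 2)%R]
     <= (2 * (2 * m%:R + 1) / (m%:R ^+ 2 * eps ^+ 2))%:E)%E.
Proof.
move=> /andP[eps0 eps12] m0 uM initE freshE noiseE indep dtilde dens.
have mR0 : 0 < m%:R :> R by rewrite ltr0n.
have [eps_neq0 m_neq0] : eps != 0 /\ m%:R != 0 :> R by rewrite !gt_eqF.
set s := 1 / (eps * m%:R) in noiseE.
have s0 : 0 < s by rewrite divr_gt0// mulr_gt0.
(* A fixed source draw is selected for each index; [B i] below is then the event that the final bit
   of user [i] is 1. *)
have /choice[src srcP] := dde_bits_source M T S.
pose B i := dde_heads init fresh (src i).
have mB i : measurable (B i) by exact: measurable_dde_heads.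
have PB i : P (B i) = (1 / 2 + eps / 4 * (tnth M i \in S)%:R)%:E.
  have := srcP i; rewrite /B; case: (src i) => [j [_ /negbTE -> _]|t [_ -> _]].
    rewrite mulr0 addr0 -[LHS]/(distribution P (init j) [set true]%classic).
    rewrite initE bernoulli_probE; last by lra.
    by rewrite !diracE mem_set// memNset//= mule1 mule0 adde0.
  rewrite mulr1 -[LHS]/(distribution P (fresh t) [set true]%classic).
  rewrite freshE bernoulli_probE; last by lra.
  by rewrite !diracE mem_set// memNset//= mule1 mule0 adde0.
(* An initial draw determines its index; a fresh draw determines the user, hence the index by
   [uniq M]. *)
have src_inj : injective src.
  move=> i j ij; have := srcP i; have := srcP j; rewrite ij.
  case: (src j) => [k [-> _ _] [-> _ _]//|t [Mj _ _] [Mi _ _]].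
  by apply/(tuple_uniqP _ uM); rewrite -Mi -Mj.
pose c := 4 / (eps * m%:R).
have B2 i : (\1_(B i) : Omega -> R) \in Lfun P 2%:E by exact: Lfun2_indic.
have Z2 : (noise : Omega -> R) \in Lfun P 2%:E.
  exact: (Lfun2_laplace s0 noiseE).
pose bits : Omega -> R := \sum_(i <- enum 'I_m) \1_(B i).
have bits2 : bits \in Lfun P 2%:E by exact: Lfun2_sum.
have cbits2 : c \o* bits \in Lfun P 2%:E by rewrite Lfun_scale// ler1n.
have bitE w i :
    dde_bits M S [ffun j => init j w] [tuple fresh t w | t < T] i = (w \in B i).
  rewrite /B; have := srcP i; case: (src i) => [j|t] [_ _ ->].
    by rewrite ffunE; apply/idP/idP; rewrite in_setE.
  by rewrite tnth_mktuple; apply/idP/idP; rewrite in_setE.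
(* The estimate is affine in the bits: [c] is the coefficient of their sum, and the constant is 4 /
   eps times -1/2. *)
have dtildeE : dtilde = (cst (- (2 / eps)) \+ (c \o* bits \+ noise))%R.
  apply/funext => w; rewrite /dtilde /dde_estimate /dde_output/= addrA.
  congr (_ + _); rewrite /bits fct_sumE big_enum/=.
  rewrite (eq_bigr (fun i => \1_(B i) w)) => [|i _].
    by rewrite /c; field; rewrite eps_neq0 m_neq0.
  by rewrite indicE -bitE.
have Ebits : ('E_P[bits] =
    (\sum_(i < m) (1 / 2 + eps / 4 * (tnth M i \in S)%:R))%:E)%E.
  rewrite /bits -[X in 'E_P[X]%E](big_map (fun i => \1_(B i)) xpredT id).
  rewrite expectation_sum => [|X /mapP[i _ ->]]; last exact: Lfun2_Lfun1.
  rewrite big_map big_enum -sumEFin; apply: eq_bigr => i _.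
  by rewrite expectation_indic// PB.
have EZ : ('E_P[noise] = 0)%E.
  rewrite expectation_def; apply: (integral_indep_laplace s0) => //.
  by move=> A mA; rewrite setTI probability_setT mul1e.
have meanE : 'E_P[dtilde]%E = dens%:E.
  rewrite dtildeE expectationD ?Lfun_cst//; last by rewrite rpredD ?Lfun2_Lfun1.
  rewrite expectationD ?expectationZl ?Lfun2_Lfun1// EZ Ebits expectation_cst.
  rewrite adde0 -EFinM -EFinD; congr EFin.
  rewrite /dens density_tuple// big_split/= sumr_const card_ord -mulr_sumr.
  by rewrite -[(1 / 2) *+ m]mulr_natr /c; field; rewrite eps_neq0 m_neq0.
split => //.
(* Since the estimate is unbiased, its mean squared error is its variance. *)
have -> : 'E_P[fun w => ((dtilde w - dens) ^+ 2)%R]%E = 'V_P[dtilde]%E.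
  by rewrite /variance covariance.unlock meanE.
rewrite dtildeE varianceD_cst_l; last by rewrite rpredD ?lee1n.
rewrite varianceD// varianceZ//.
(* The noise has mean 0, so its covariance with a bit is its integral over [B i], which vanishes by
   independence. *)
have -> : (covariance P (c \o* bits) noise = 0)%E.
  rewrite covarianceZl ?(Lfun2_mul_Lfun1 bits2 Z2)//; try exact: Lfun2_Lfun1.
  rewrite covariance_suml_eq0 ?mule0// => i _.
  rewrite covarianceE ?(Lfun2_mul_Lfun1 (B2 i) Z2)//; try exact: Lfun2_Lfun1.
  rewrite EZ mule0 sube0 unlock.
  rewrite -[RHS](integral_indep_laplace s0 noiseE (B i))//.
    rewrite [RHS]integral_mkcond; apply: eq_integral => w _.
    by rewrite epatch_indic muleC -EFinM.
  by move=> A mA; exact: dde_heads_noise_indep indep _ _ mA.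
have Vbits : ('V_P[bits] <= (m%:R / 4)%:E)%E.
  rewrite variance_sum_uncorrelated ?enum_uniq// => [|i j ij]; last first.
    apply: covariance_indic_indep => //; apply: (dde_heads_indep _ _ _ indep).
    by apply: contra ij => /eqP/src_inj ->.
  rewrite big_enum/=; apply: (@le_trans _ _ (\sum_(i < m) (1 / 4)%:E)%E).
    by apply: lee_sum => i _; exact: variance_indic_le.
  by rewrite sumEFin sumr_const card_ord lee_fin div1r -[X in X <= _]mulr_natl.
have VZ : ('V_P[noise] = (2 * s ^+ 2)%:E)%E.
  rewrite varianceE// EZ expe2 mule0 sube0 unlock.
  exact: (expectation_sqr_laplace s0 noiseE).
rewrite mule0 adde0 VZ.
apply: (@le_trans _ _ ((c ^+ 2)%:E * (m%:R / 4)%:E + (2 * s ^+ 2)%:E)%E).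
  by rewrite leeD2r// lee_wpmul2l// lee_fin sqr_ge0.
(* Equality holds here: c^2 m / 4 = 4 / (eps^2 m) and 2 s^2 = 2 / (eps^2 m^2) add up to the stated
   bound. *)
rewrite -EFinM -EFinD lee_fin le_eqVlt; apply/orP; left; apply/eqP.
by rewrite /c /s; field; rewrite eps_neq0 m_neq0.
Qed.
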